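(* Let $\Sigma=\{a,b\}$, let $\epsilon$ be the empty string, and let $L=\{a^nb^n y\mid n>0,\ y\in\Sigma^*\}\cup\{\epsilon\}$. Then $L\in D_1(\text{s-QRNN}\circ\text{s-QRNN})$: there exist a two-layer s-QRNN over $\Sigma$ with final (second-layer) state $\mathbf h_{|x|}\in\mathbb{Q}^k$ on input $x$, and $\mathbf w\in\mathbb{Q}^k$, $\beta\in\mathbb{Q}$, such that for all $x\in\Sigma^*$: $\mathbf w\cdot\mathbf h_{|x|}+\beta>0$ if and only if $x\in L$.
   Context: QRNN of window length $w$ and dimension $k$ on a sequence of input vectors $\mathbf x_1,\mathbf x_2,\dots$ with matrix $\mathbf X$: let $\mathbf z_t,\mathbf f_t,\mathbf i_t,\mathbf o_t\in\mathbb{Q}^k$ be the rows of $\mathbf Z=\tanh(\mathbf W^z*\mathbf X)$, $\mathbf F=\sigma(\mathbf W^f*\mathbf X)$, $\mathbf I=\sigma(\mathbf W^i*\mathbf X)$, $\mathbf O=\sigma(\mathbf W^o*\mathbf X)$, where $*$ is convolution over time with window length $w$, rational weights, and rational biases allowed (so row $t$ is the activation applied to an affine function of $\mathbf x_{t-w+1},\dots,\mathbf x_t$, zero-padded before the start). Then $\mathbf c_0=\mathbf h_0=\mathbf 0$, $\mathbf c_t=\mathbf f_t\odot\mathbf c_{t-1}+\mathbf i_t\odot\mathbf z_t$, $\mathbf h_t=\mathbf o_t\odot\mathbf c_t$. Two-layer network ($\circ$ denotes stacking): the first layer reads the embedded input tokens (embedding $\Sigma\to\mathbb{Q}^{d_x}$),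 and the sequence of its output states $\mathbf h_1,\dots,\mathbf h_{|x|}$ is the input sequence of the second layer; the final state is that of the second layer. Saturation: the s-QRNN is the QRNN in which $\sigma$ is replaced by the step function equal to $1$ on positive and $0$ on negative arguments, and $\tanh$ by the sign function with values in $\{-1,0,1\}$; parameters are such that no argument of a $\sigma$ is exactly $0$ on any input, so all gates lie in $\{0,1\}$. $D_1(E)$ is the set of languages decided by an encoder of type $E$ followed by a linear threshold decoder $\mathbf d_1(\mathbf h)=\mathbb{1}_{>0}(\mathbf w\cdot\mathbf h+\beta)$ applied to the final state. *)

(* Defs.v *)
From mathcomp Require Import all_boot all_order all_algebra.
Set Implicit Arguments.
Unset Strict Implicit.
Unset Printing Implicit Defensive.

Import Order.TTheory GRing.Theory Num.Theory.
Local Open Scope ring_scope.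

Definition language (S : Type) := seq S -> Prop.

(* Affine convolution filter over time, of window length [w]; the matrix
   [weight A j] multiplies the input of lag [j], i.e. x_(t - j). *)
Record affine_filter (d w k : nat) := AffineFilter {
  weight : 'I_w -> 'M[rat]_(d, k);
  bias : 'rV[rat]_k }.

(* The sequence x_1, ..., x_n is [xs]. Times are counted from 1, and
   [(0 :: xs)`_s] is x_s if 1 <= s <= n and 0 if s = 0; as [t - j] is truncated
   at 0, the window is zero-padded before the start. *)
Definition conv d w k (A : affine_filter d w k) (xs : seq 'rV[rat]_d) (t : nat)
    : 'rV[rat]_k :=
  bias A + \sum_(j < w) (0 :: xs)`_(t - j)%N *m weight A j.

Definition hadamard k (u v : 'rV[rat]_k) : 'rV[rat]_k := map2_mx *%R u v.

Record qrnn (d w k : nat) := QRNN {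
  filter_z : affine_filter d w k;
  filter_f : affine_filter d w k;
  filter_i : affine_filter d w k;
  filter_o : affine_filter d w k }.

(* [sigma] and [tau] are the activations of the gates and of z respectively
   (the logistic function and tanh before saturation). *)
Fixpoint qrnn_cell (sigma tau : rat -> rat) d w k (N : qrnn d w k)
    (xs : seq 'rV[rat]_d) (t : nat) : 'rV[rat]_k :=
  if t is s.+1 then
    hadamard (map_mx sigma (conv (filter_f N) xs t))
             (qrnn_cell sigma tau N xs s)
    + hadamard (map_mx sigma (conv (filter_i N) xs t))
               (map_mx tau (conv (filter_z N) xs t))
  else 0.

Definition qrnn_state (sigma tau : rat -> rat) d w k (N : qrnn d w k)
    (xs : seq 'rV[rat]_d) (t : nat) : 'rV[rat]_k :=
  if t is _.+1 then
    hadamard (map_mx sigma (conv (filter_o N) xs t))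
             (qrnn_cell sigma tau N xs t)
  else 0.

Definition step (x : rat) : rat := (0 < x)%R%:R.

Definition sqrnn_state d w k (N : qrnn d w k) (xs : seq 'rV[rat]_d) (t : nat)
    : 'rV[rat]_k :=
  qrnn_state step Num.sg N xs t.

Definition sqrnn_outputs d w k (N : qrnn d w k) (xs : seq 'rV[rat]_d)
    : seq 'rV[rat]_k :=
  [seq sqrnn_state N xs t | t <- iota 1 (size xs)].

Definition sqrnn_final d w k (N : qrnn d w k) (xs : seq 'rV[rat]_d)
    : 'rV[rat]_k :=
  sqrnn_state N xs (size xs).

(* No gate is evaluated at the discontinuity of [step]. The argument of the
   sign function may vanish. *)
Definition saturated_on d w k (N : qrnn d w k) (xs : seq 'rV[rat]_d) : Prop :=
  forall (t : nat) (j : 'I_k), (0 < t <= size xs)%N ->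
    [/\ conv (filter_f N) xs t 0 j != 0,
        conv (filter_i N) xs t 0 j != 0
      & conv (filter_o N) xs t 0 j != 0].

Definition encoder_type (S : Type) :=
  forall k : nat, (seq S -> 'rV[rat]_k) -> Prop.

Definition sqrnn_o_sqrnn (S : Type) : encoder_type S := fun k enc =>
  exists (dx w1 k1 w2 : nat) (emb : S -> 'rV[rat]_dx)
         (N1 : qrnn dx w1 k1) (N2 : qrnn k1 w2 k),
    [/\ (0 < w1)%N /\ (0 < w2)%N,
        forall x : seq S, saturated_on N1 (map emb x),
        forall x : seq S, saturated_on N2 (sqrnn_outputs N1 (map emb x))
      & forall x : seq S,
          enc x = sqrnn_final N2 (sqrnn_outputs N1 (map emb x))].

Definition decoder1 k (w : 'rV[rat]_k) (beta : rat) (h : 'rV[rat]_k) : bool :=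
  0 < (\sum_(j < k) w 0 j * h 0 j) + beta.

Definition D1 (S : Type) (E : encoder_type S) (L : language S) : Prop :=
  exists (k : nat) (enc : seq S -> 'rV[rat]_k) (w : 'rV[rat]_k) (beta : rat),
    E k enc /\ forall x : seq S, decoder1 w beta (enc x) <-> L x.

Inductive letter : Set := la | lb.

Definition anbn_prefix : language letter := fun x =>
  (exists (n : nat) (y : seq letter),
     (0 < n)%N /\ x = nseq n la ++ nseq n lb ++ y)
  \/ x = [::].

(* Main.v *)
Require Import Defs.
From mathcomp Require Import all_boot all_order all_algebra.
From mathcomp Require Import lra zify.

(** In the first layer, one unit computes the difference c_t between the numbers
    of a's and b's read so far, and another a flag g_t which is set by an
    initial a and reset by every factor ba, so that g_t = 1 exactly when the
    prefix of length t lies in a^+ b^*. A nonempty word is in the language iff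
    g_t = 1 and c_t <= 0 for some t. The second layer counts these t, and has a
    unit that is 1 on nonempty words and singles out the empty one. *)

Set Implicit Arguments.
Unset Strict Implicit.
Unset Printing Implicit Defensive.

Import Order.TTheory GRing.Theory Num.Theory.
Local Open Scope ring_scope.

Definition row2 (u v : rat) : 'rV[rat]_2 := \row_j (if j == 0 then u else v).

Definition mx2 (a b c d : rat) : 'M[rat]_2 :=
  \matrix_(i, j) row2 (row2 a b 0 j) (row2 c d 0 j) 0 i.

(** [W0] acts on the current input and [W1] on the previous one; seeing two adjacent letters is
    enough to detect a factor ba. *)
Definition filter2 (W0 W1 : 'M[rat]_2) (b : 'rV[rat]_2) : affine_filter 2 2 2 :=
  AffineFilter (fun j => if j == 0 then W0 else W1) b.

Lemma row2P (u v : 'rV[rat]_2) : u 0 0 = v 0 0 -> u 0 1 = v 0 1 -> u = v.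
Proof.
move=> e0 e1; apply/rowP => -[[|[|//]] lt_j2].
- by rewrite (_ : Ordinal lt_j2 = 0) //; apply: val_inj.
- by rewrite (_ : Ordinal lt_j2 = 1) //; apply: val_inj.
Qed.

Lemma row2_neq0 u v j : u != 0 -> v != 0 -> row2 u v 0 j != 0.
Proof. by move=> u0 v0; rewrite mxE; case: ifP. Qed.

Lemma row2_00 : row2 0 0 = 0.
Proof. by apply: row2P; rewrite !mxE. Qed.

Lemma row2D u v u' v' : row2 u v + row2 u' v' = row2 (u + u') (v + v').
Proof. by apply: row2P; rewrite !mxE. Qed.

Lemma map_row2 f u v : map_mx f (row2 u v) = row2 (f u) (f v).
Proof. by apply: row2P; rewrite !mxE. Qed.

Lemma hadamard_row2 u v u' v' :
  hadamard (row2 u v) (row2 u' v') = row2 (u * u') (v * v').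
Proof. by apply: row2P; rewrite !mxE. Qed.

Lemma mul_row2_mx2 u v a b c d :
  row2 u v *m mx2 a b c d = row2 (u * a + v * c) (u * b + v * d).
Proof. by apply: row2P; rewrite !mxE !big_ord_recl big_ord0 addr0 !mxE. Qed.

Lemma conv_filter2 W0 W1 b xs t :
  conv (filter2 W0 W1 b) xs t.+1
  = b + ((0 :: xs)`_t.+1 *m W0 + (0 :: xs)`_t *m W1).
Proof. by rewrite /conv !big_ord_recl big_ord0 addr0 subn0 subn1. Qed.

Definition is_a l := if l is la then true else false.

Definition emb l := row2 (is_a l)%:R (~~ is_a l)%:R.

Definition no_ba l l' := is_a l' ==> is_a l.

(** Stated through adjacent letters rather than exponents, so that appending a letter changes it as
    the gates change g. *)
Definition in_apbs p := if p is l :: q then is_a l && path no_ba l q else false.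

Definition balance p : rat := (count is_a p)%:R - (count (predC is_a) p)%:R.

(** Rows of the weight matrices are indexed by the inputs (a, b), columns by the
    units (c, g). The gates f and i of g have arguments 3 - 2 a_t - 2 b_(t-1)
    and 2 a_t - 2 (a_(t-1) + b_(t-1)) - 1; the latter is positive only at an
    initial a, because the padding is the only input with a + b = 0. *)
Definition layer1 : qrnn 2 2 2 := QRNN
  (filter2 (mx2 1 0 (-1) 0) (mx2 0 0 0 0) (row2 0 1))
  (filter2 (mx2 0 (-2) 0 0) (mx2 0 0 0 (-2)) (row2 1 3))
  (filter2 (mx2 0 2 0 0) (mx2 0 (-2) 0 (-2)) (row2 1 (-1)))
  (filter2 (mx2 0 0 0 0) (mx2 0 0 0 0) (row2 1 1)).

(** The increment of the first unit is [1 - 2 c_t > 0] * sgn g_t. *)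
Definition layer2 : qrnn 2 2 2 := QRNN
  (filter2 (mx2 0 0 1 0) (mx2 0 0 0 0) (row2 0 1))
  (filter2 (mx2 0 0 0 0) (mx2 0 0 0 0) (row2 1 (-1)))
  (filter2 (mx2 (-2) 0 0 0) (mx2 0 0 0 0) (row2 1 1))
  (filter2 (mx2 0 0 0 0) (mx2 0 0 0 0) (row2 1 1)).

Lemma nseq_catP p : reflect
  (exists n m, (0 < n)%N /\ p = nseq n la ++ nseq m lb) (in_apbs p).
Proof.
have path_lb q : path no_ba lb q -> q = nseq (size q) lb.
  by elim: q => //= -[|] q IHq //= /IHq {1}->.
apply: (iffP idP) => [|[[|n] [m [// _ ->]]] /=]; last first.
  elim: n => //= ; case: m => //= m; elim: m => //.
case: p => // -[] //= q; elim: q => [|[] q IHq] /=; first by exists 1, 0.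
- by case/IHq=> n [m [n_gt0 ->]]; exists n.+1, m.
- by move/path_lb=> ->; exists 1, (size q).+1.
Qed.

Lemma in_apbs_rcons p l : in_apbs (rcons p l)
  = if p is l' :: q then in_apbs p && no_ba (last l' q) l else is_a l.
Proof. by case: p => [|l' q] /=; rewrite ?andbT // rcons_path andbA. Qed.

Lemma balance_rcons p l :
  balance (rcons p l) = balance p + (is_a l)%:R - (~~ is_a l)%:R.
Proof. by rewrite /balance -cats1 !count_cat /= !addn0 !natrD; lra. Qed.

Lemma nth_emb x t : (t < size x)%N -> (0 :: map emb x)`_t.+1 = emb (nth la x t).
Proof. by move=> lt_tx; rewrite /= (nth_map la). Qed.

(** Expresses the lag-one input through the prefix already read; at [t = 0] both sides are the zero
    padding. *)
Lemma nth_emb_last x t : (t <= size x)%N ->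
  (0 :: map emb x)`_t = last 0 (map emb (take t x)).
Proof.
move=> le_tx; rewrite (last_nth 0) size_map size_takel //.
by case: t le_tx => //= t le_tx; rewrite !(nth_map la) ?size_takel ?nth_take.
Qed.

Lemma last_emb p : last 0 (map emb p)
  = if p is l :: q then emb (last l q) else row2 0 0.
Proof. by case: p => [|l q] /=; rewrite ?row2_00 // last_map. Qed.

Lemma step_gt0 x : 0 < x -> step x = 1. Proof. by rewrite /step => ->. Qed.
Lemma step_lt0 x : x < 0 -> step x = 0.
Proof. by move/lt_gtF; rewrite /step => ->. Qed.

Ltac eval_activations := repeat match goal with
  | |- context [step ?e] =>
      first [rewrite (@step_gt0 e); last lra | rewrite (@step_lt0 e); last lra]
  | |- context [Num.sg ?e] =>
      first [rewrite (@gtr0_sg _ e); last lra | rewrite (@ltr0_sg _ e); last lra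
            | rewrite (_ : e = 0) ?sgr0; last lra]
  end.

Definition row2_simp := (mul_row2_mx2, row2D, map_row2, hadamard_row2).

Definition state1 p := row2 (balance p) (in_apbs p)%:R.

Lemma state1_nil : state1 [::] = 0.
Proof. by rewrite /state1 /balance subrr row2_00. Qed.

Lemma cell1E x t : (t <= size x)%N ->
  qrnn_cell step Num.sg layer1 (map emb x) t = state1 (take t x).
Proof.
elim: t => [|t IHt] lt_tx; first by rewrite take0 state1_nil.
cbn [qrnn_cell filter_f filter_i filter_z layer1].
rewrite IHt 1?ltnW // !conv_filter2 nth_emb // nth_emb_last 1?ltnW //.
rewrite (take_nth la lt_tx) /state1 balance_rcons in_apbs_rcons last_emb /emb.
(* Once the new letter and the previous one (or the padding) are fixed, all activation arguments are
   numerals. *)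
case: (nth la x t); case: (take t x) => [|l q]; try case: (last l q);
  rewrite !row2_simp /no_ba ?andbT ?andbF /=; eval_activations;
  congr row2; lra.
Qed.

(** The gates have even weights, odd biases and inputs in {0, 1}, so their arguments are odd
    integers. *)
Lemma saturated1 x : saturated_on layer1 (map emb x).
Proof.
move=> [//|t] j; rewrite size_map => /andP[_ lt_tx].
cbn [filter_f filter_i filter_o layer1].
rewrite !conv_filter2 nth_emb // nth_emb_last 1?ltnW // last_emb /emb.
split; case: (nth la x t); case: (take t x) => [|l q]; try case: (last l q);
  rewrite !row2_simp; apply: row2_neq0; apply/eqP => /= ?; lra.
Qed.

(** The output gates are constantly 1, and the padding agrees with the state on the empty prefix. *)
Lemma outputs1E x t : (t <= size x)%N ->
  (0 :: sqrnn_outputs layer1 (map emb x))`_t = state1 (take t x).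
Proof.
case: t => [|t] lt_tx; first by rewrite take0 state1_nil.
rewrite /= (nth_map 0%N) ?size_iota ?size_map // nth_iota ?size_map //.
rewrite /sqrnn_state /qrnn_state add1n; cbn [filter_o layer1].
rewrite cell1E // conv_filter2 nth_emb // nth_emb_last 1?ltnW // last_emb /emb.
case: (take t x) => [|l q]; rewrite /state1 !row2_simp;
  eval_activations; by rewrite !mul1r.
Qed.

Definition hit p :=
  (count is_a p <= count (predC is_a) p)%N && in_apbs p.

(** As an odd natural number minus an even one, this gate argument never vanishes, and its strict
    positivity amounts to c_t <= 0. *)
Lemma balanceE p : 1 - 2 * balance p
  = (count (predC is_a) p).*2.+1%:R - (count is_a p).*2%:R.
Proof. by rewrite /balance -addn1 -!muln2 natrD !natrM; lra. Qed.

Lemma step_balance p :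
  step (1 - 2 * balance p) = (count is_a p <= count (predC is_a) p)%N%:R.
Proof. by rewrite balanceE /step subr_gt0 ltr_nat ltnS leq_double. Qed.

Lemma balance_neq0 p : 1 - 2 * balance p != 0.
Proof.
rewrite balanceE subr_eq0 eqr_nat; apply/eqP => /(congr1 odd).
by rewrite /= !odd_double.
Qed.

Lemma sg_nat (b : bool) : Num.sg (b%:R : rat) = b%:R.
Proof. by case: b; rewrite ?sgr0 ?sgr1. Qed.

Definition hits x t := count (fun s => hit (take s x)) (iota 1 t).

Lemma hitsS x t : hits x t.+1 = (hits x t + hit (take t.+1 x))%N.
Proof. by rewrite /hits -(addn1 t) iotaD count_cat /= addn0 add1n addn1. Qed.

Definition conv2_simp :=
  (mul_row2_mx2, row2D, map_row2, mulr0, addr0, add0r, mulr1).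

Lemma cell2E x t : (t <= size x)%N ->
  qrnn_cell step Num.sg layer2 (sqrnn_outputs layer1 (map emb x)) t
  = row2 (hits x t)%:R (0 < t)%N%:R.
Proof.
elim: t => [|t IHt] lt_tx; first by rewrite /hits row2_00.
cbn [qrnn_cell filter_f filter_i filter_z layer2].
rewrite (IHt (ltnW lt_tx)) !conv_filter2 !outputs1E ?(ltnW lt_tx) //.
(* The conjunction in [hit] becomes a product: the input gate gives the comparison of counts, and z
   gives the flag. *)
rewrite /state1 !conv2_simp !hadamard_row2 row2D hitsS natrD /hit -mulnb natrM.
rewrite -step_balance sg_nat mulrN [_ * 2]mulrC; eval_activations.
by congr row2; rewrite ?sgr1 ?mul1r ?mul0r ?add0r.
Qed.

Lemma saturated2 x : saturated_on layer2 (sqrnn_outputs layer1 (map emb x)).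
Proof.
move=> [//|t] j; rewrite size_map size_iota size_map => /andP[_ lt_tx].
cbn [filter_f filter_i filter_o layer2].
rewrite !conv_filter2 !outputs1E ?(ltnW lt_tx) //.
rewrite /state1 !conv2_simp mulrN [_ * 2]mulrC.
by split; apply: row2_neq0 => //; apply: balance_neq0.
Qed.

Lemma final2E x : sqrnn_final layer2 (sqrnn_outputs layer1 (map emb x))
  = row2 (hits x (size x))%:R (0 < size x)%N%:R.
Proof.
rewrite /sqrnn_final size_map size_iota size_map /sqrnn_state /qrnn_state.
case E: (size x) => [|t]; first by rewrite /hits row2_00.
rewrite cell2E ?E //; cbn [filter_o layer2].
rewrite conv_filter2 !outputs1E ?E // /state1 !conv2_simp hadamard_row2.
by eval_activations; rewrite !mul1r.
Qed.

Lemma anbn_prefixP x :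
  reflect (anbn_prefix x) ((size x == 0)%N || (0 < hits x (size x))%N).
Proof.
have count_ab n m : ((count is_a (nseq n la ++ nseq m lb) = n)
    * (count (predC is_a) (nseq n la ++ nseq m lb) = m))%type.
  by rewrite !count_cat !count_nseq /= !mul1n !mul0n addn0.
rewrite -has_count.
apply: (iffP orP) => [[/nilP-> | /hasP[s _ /andP[le_ab]]] | ].
- by right.
- case/nseq_catP=> n [m [n_gt0 def_s]]; left.
  move: le_ab; rewrite def_s !count_ab => le_nm.
  (* The hit prefix is a^n b^m with n <= m; its surplus b's go into y. *)
  exists n, (nseq (m - n) lb ++ drop s x); split=> //.
  by rewrite (catA (nseq n lb)) -nseqD subnKC // catA -def_s cat_take_drop.
case=> [[n [y [n_gt0 def_x]]] | ->]; [right | by left].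
have take_x : take (n + n) x = nseq n la ++ nseq n lb.
  by rewrite def_x catA take_size_cat // size_cat !size_nseq.
(* The prefix a^n b^n itself is a hit. *)
apply/hasP; exists (n + n)%N.
  by rewrite mem_iota addn_gt0 n_gt0 def_x !size_cat !size_nseq /=; lia.
rewrite /hit take_x !count_ab leqnn.
by apply/nseq_catP; exists n, n.
Qed.

Theorem theorem12 : D1 (@sqrnn_o_sqrnn letter) anbn_prefix.
Proof.
exists 2, (fun x => sqrnn_final layer2 (sqrnn_outputs layer1 (map emb x))).
(* The decoder computes 1/2 on the empty word and the number of hits minus 1/2 on all others. *)
exists (row2 1 (-1)), (1 / 2); split.
  exists 2, 2, 2, 2, emb, layer1, layer2; split=> //.
  - exact: saturated1.
  - exact: saturated2.
move=> x; apply: (iff_trans _ (iff_sym (rwP (anbn_prefixP x)))).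
rewrite /decoder1 final2E !big_ord_recl big_ord0 !mxE /=.
case: (posnP (size x)) => [size0 | size_gt0] /=.
  by rewrite /hits size0 /=; split=> // _; lra.
case: (hits x (size x)) => [|h] /=; first by split=> //; lra.
rewrite -natr1; split=> // _; have := ler0n rat h; lra.
Qed.
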